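(* Let $1\le j\le n$ and let $i_1,\dots,i_j\in[n]$ be distinct. Let $k_1<k_2<\cdots<k_j$ be the increasing rearrangement of $i_1,\dots,i_j$, and set $k_0=0$. Then $$P_n^{\text{park}}(\sigma^{-1}_{n-j+1}=i_1,\ \sigma^{-1}_{n-j+2}=i_2,\ \dots,\ \sigma^{-1}_n=i_j)=\frac{(n-j)!\left(\prod_{l=1}^j(k_l-k_{l-1})^{k_l-k_{l-1}-2}\right)(n-k_j+1)^{n-k_j-1}\prod_{l=1}^j\tilde l_{n,n-j+l}(\sigma)}{(n+1)^{n-1}\left(\prod_{l=1}^j(k_l-k_{l-1}-1)!\right)(n-k_j)!},$$ where on the right-hand side $\sigma$ is any permutation in $S_n$ with $\sigma^{-1}_{n-j+l}=i_l$ for $l=1,\dots,j$ (the values $\tilde l_{n,n-j+l}(\sigma)$, $l=1,\dots,j$, depend only on $i_1,\dots,i_j$).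
   Context: $[n]=\{1,\dots,n\}$ and $S_n$ is the set of permutations $\sigma=\sigma_1\cdots\sigma_n$ of $[n]$; $\sigma^{-1}_k=j$ if and only if $\sigma_j=k$. Parking: cars $1,\dots,n$ arrive in this order on a one-way street with spaces $1,\dots,n$; given a sequence $\pi=(\pi_1,\dots,\pi_n)\in[n]^n$ of preferred spaces, car $i$ parks in space $\pi_i$ if it is free, and otherwise in the first free space with number greater than $\pi_i$, if one exists (if none exists the car exits the street). $\pi$ is a parking function on $[n]$ if all $n$ cars are able to park; $\mathcal{P}_n$ is the set of parking functions on $[n]$. The map $T_n:\mathcal{P}_n\to S_n$ is $T_n(\pi)=\sigma$, where $\sigma_j$ is the number of the car that parked in space $j$, $j\in[n]$. The probability measure $P_n^{\text{park}}$ on $S_n$ is $P_n^{\text{park}}(\sigma)=|T_n^{-1}(\{\sigma\})|/|\mathcal{P}_n|$. For $1\le i\le n$ and $\sigma\in S_n$, $l_{n,i}(\sigma)=\max\{l\in[i]:\ \sigma_i=\max(\sigma_i,\sigma_{i-1},\dots,\sigma_{i-l+1})\}$, and $\tilde l_{n,i}(\sigma)=l_{n,\sigma^{-1}_i}(\sigma)$. *)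

(* Defs.v *)
From mathcomp Require Import all_boot all_order all_algebra all_fingroup.
Set Implicit Arguments.
Unset Strict Implicit.
Unset Printing Implicit Defensive.
Import GRing.Theory.

(* Cars and parking spaces are both elements of 'I_n, so the car (or space)
   numbered c in [n] is the ordinal of value c - 1.  Cars arrive in increasing
   order.  A permutation sigma sends a space to the car parked there. *)

Definition street n := {ffun 'I_n -> option 'I_n}.

Definition empty_street n : street n := [ffun=> None].

(* enum 'I_n is increasing, so ohead returns the first free space beyond p. *)
Definition target n (s : street n) (p : 'I_n) : option 'I_n :=
  if s p == None then Some p
  else ohead [seq q : 'I_n <- enum 'I_n | (p < q) && (s q == None)].

Definition park_car n (pi : {ffun 'I_n -> 'I_n}) (s : street n) (c : 'I_n) :
    street n :=
  if target s (pi c) is Some p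
  then [ffun q => if q == p then Some c else s q]
  else s.

Definition parked n (pi : {ffun 'I_n -> 'I_n}) : street n :=
  foldl (park_car pi) (empty_street n) (enum 'I_n).

Definition parking_functions n : {set {ffun 'I_n -> 'I_n}} :=
  [set pi | [forall c, [exists q, parked pi q == Some c]]].

(* The map T_n; the default value 1 is never used on parking functions, see
   parking_outcomeP. *)
Definition parking_outcome n (pi : {ffun 'I_n -> 'I_n}) : 'S_n :=
  odflt 1%g [pick sigma : 'S_n | [forall q, parked pi q == Some (sigma q)]].

Lemma parking_outcomeP n (pi : {ffun 'I_n -> 'I_n}) :
  pi \in parking_functions n ->
  forall q, parked pi q = Some (parking_outcome pi q).
Proof.
rewrite inE => /forallP parkP.
have exq c : exists q, parked pi q == Some c by apply/existsP.
pose f c := xchoose (exq c).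
have fP c : parked pi (f c) = Some c by apply/eqP/(xchooseP (exq c)).
have f_inj : injective f.
  by move=> c d efcd; apply: Some_inj; rewrite -fP efcd fP.
rewrite /parking_outcome; case: pickP => [sigma /forallP sigmaP q | noS].
  exact/eqP.
have /negP[] := negbT (noS (perm f_inj)^-1%g).
by apply/forallP=> q; rewrite -{1}(permKV (perm f_inj) q) permE fP.
Qed.

Local Open Scope ring_scope.

Definition Ppark n (sigma : 'S_n) : rat :=
  #|[set pi in parking_functions n | parking_outcome pi == sigma]|%:R
    / #|parking_functions n|%:R.

Definition Ppark_event n (A : {set 'S_n}) : rat :=
  \sum_(sigma in A) Ppark sigma.

Local Close Scope ring_scope.

(* The length-l window of spaces ending at i consists of the q with
   i - l + 1 <= q <= i; the first inequality is written without truncated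
   subtraction.  Since i is 0-based, l ranges over 1, ..., i.+1. *)
Definition run_length n (i : 'I_n) (sigma : 'S_n) : nat :=
  \max_(l < n.+1 | (0 < l <= i.+1) &&
      ((sigma i : nat) == \max_(q < n | (i < q + l) && (q <= i)) sigma q)) l.

Definition run_length_car n (c : 'I_n) (sigma : 'S_n) : nat :=
  run_length ((sigma^-1)%g c) sigma.

(* For m of value l - 1, the car numbered n - j + l. *)
Definition last_car n j (hjn : j <= n) (m : 'I_j) : 'I_n :=
  cast_ord (subnK hjn) (rshift (n - j) m).

Definition last_cars_at n j (hjn : j <= n) (i : 'I_j -> 'I_n) : {set 'S_n} :=
  [set sigma : 'S_n | [forall m, (sigma^-1)%g (last_car hjn m) == i m]].

(* Main.v *)
Require Import Defs.
From mathcomp Require Import all_boot all_order all_algebra all_fingroup.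
From mathcomp Require Import zify ring.
Set Implicit Arguments.
Unset Strict Implicit.
Unset Printing Implicit Defensive.
Import GRing.Theory Num.Theory.
Local Open Scope ring_scope.

(** Fix an outcome sigma.  A preference vector leads to sigma exactly when each
    car c, arriving after the cars below c have taken their spaces, is sent to
    its own space, and the preferences doing this form the window of length
    [run_length_car c sigma] that ends there.  The choices of different cars
    being independent, sigma has [\prod_c run_length_car c sigma] parking
    functions above it ([card_outcome]).

    Moreover [run_length_car c sigma] only depends on where the cars numbered c
    and above are parked ([eq_run_length_car]).  In the event, the positions of
    the last j cars are prescribed, so their run lengths come out as constants;
    what is left is the sum, over all ways to park the first n - j cars on the
    remaining spaces, of the product of their run lengths.

    Let N(S) be that sum when the first |S| cars fill a set S of spaces.
    Splitting according to the space p of the last of them gives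
    N(S) = sum over p in S of run(p, S) N(S minus p), where run(p, S) is the
    number of consecutive spaces of S that end at p.  The solution is
    N(S) = |S|! times the product, over the maximal intervals of S, of
    (m+1)^(m-1) / m!, where m is the length of the interval: since removing p
    only splits the interval of p, the recursion reduces to a convolution identity
    for a single interval, [park_density_convolution], which is an instance of
    Abel's generalization of the binomial theorem, [abel_identity].  The
    recursion is solved on streets by [street_weight_removal] and transported to
    permutations by [sum_agree_from].

    Taking S to be the whole street yields the count (n+1)^(n-1) of parking
    functions, and taking for S the complement of the prescribed spaces, whose
    intervals are the gaps between consecutive k_l, yields the theorem. *)

(** * Abel's identity *)

(** An m-th finite difference kills the polynomials of degree below m.  Induction
    on e: one factor x + k splits into x, which the induction hypothesis handles,
    and k, which is absorbed by k C(m+1, k) = (m+1) C(m, k-1). *)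
Lemma alternating_binomial_sum (R : comNzRingType) (e m : nat) (x : R) :
  (e < m)%N ->
  \sum_(k < m.+1) (-1) ^+ k * (x + k%:R) ^+ e *+ 'C(m, k) = 0.
Proof.
elim: e m x => [|e IHe] m x lt_em.
  transitivity ((1 - 1 : R) ^+ m); last first.
    by rewrite subrr expr0n gtn_eqF.
  rewrite exprDn; apply: eq_bigr => k _.
  by rewrite expr0 expr1n mul1r mulr1.
case: m lt_em => // m lt_em.
pose f (k : nat) : R := (-1) ^+ k * (x + k%:R) ^+ e.
have splitE (k : nat) : (-1) ^+ k * (x + k%:R) ^+ e.+1 *+ 'C(m.+1, k)
    = x * (f k *+ 'C(m.+1, k)) + f k *+ (k * 'C(m.+1, k)).
  rewrite /f exprS mulrnA mulrnAr -mulrnDl; congr (_ *+ _).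
  by rewrite -[X in _ = _ + X]mulr_natr; ring.
rewrite (eq_bigr _ (fun (k : 'I_m.+2) _ => splitE k)) big_split /=.
rewrite -mulr_sumr IHe ?mulr0 ?add0r; last exact: ltnW.
rewrite big_ord_recl mul0n mulr0n add0r -[RHS](mulr0 (- m.+1%:R)) -[in RHS](IHe m (x + 1)) //.
rewrite [RHS]mulr_sumr; apply: eq_bigr => k _.
rewrite lift0 -mul_bin_diag /f exprS mulrnA mulrnAr; congr (_ *+ _).
rewrite -[LHS]mulr_natr -[k.+1%:R]natr1.
by rewrite (_ : x + (k%:R + 1) = x + 1 + k%:R); ring.
Qed.

(** Expand each power of z - (k+1) in powers of z and exchange the sums.  As
    C(n, k) C(n-k, i) = C(n, i) C(n-i, k), the coefficient of z^i becomes C(n, i)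
    times an alternating sum of order n - i of the (n-i-1)-st powers, hence vanishes
    for i < n.  The truncated exponent k.-1 is harmless at k = 0, where the base
    is 1. *)
Lemma abel_identity (R : comNzRingType) (n : nat) (z : R) :
  \sum_(k < n.+1) (z - k.+1%:R) ^+ (n - k) * k.+1%:R ^+ k.-1 *+ 'C(n, k)
  = z ^+ n.
Proof.
pose a (k i : nat) : R := z ^+ i * ((-1) ^+ (n - i - k)
  * (1 + k%:R) ^+ (n - i).-1 *+ ('C(n, i) * 'C(n - i, k))).
transitivity (\sum_(k < n.+1) \sum_(i < n.+1) a k i).
  apply: eq_bigr => k _; have le_kn : (k <= n)%N by rewrite -ltnS.
  rewrite addrC exprDn (big_ord_widen n.+1 (fun i : nat =>
    (- k.+1%:R) ^+ (n - k - i) * z ^+ i *+ 'C(n - k, i))) ?ltnS ?leq_subr //.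
  rewrite mulr_suml -sumrMnl big_mkcond; apply: eq_bigr => i _.
  have le_in : (i <= n)%N by rewrite -ltnS.
  rewrite ltnS; case: (leqP i (n - k)) => [le_i | gt_i]; last first.
    by rewrite /a [X in (_ * X)%N]bin_small ?muln0 ?mulr0n ?mulr0 //; lia.
  have swapE : ('C(n, k) * 'C(n - k, i) = 'C(n, i) * 'C(n - i, k))%N.
    have fact_prod_gt0 : (0 < k`! * (i`! * (n - k - i)`!))%N.
      by rewrite !muln_gt0 !fact_gt0.
    have le_k : (k <= n - i)%N by lia.
    apply/eqP; rewrite -(eqn_pmul2r fact_prod_gt0).
    have := bin_fact le_kn; rewrite -(bin_fact le_i).
    have := bin_fact le_in; rewrite -(bin_fact le_k) subnAC.
    by move=> E1 E2; apply/eqP; lia.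
  rewrite /a -swapE mulrnAl -mulrnA mulnC mulrnAr; congr (_ *+ _).
  rewrite -natr1 [_ + 1]addrC exprNn subnAC.
  have -> : (1 + k%:R : R) ^+ (n - i).-1
      = (1 + k%:R) ^+ (n - i - k) * (1 + k%:R) ^+ k.-1.
    rewrite -exprD; case: (nat_of_ord k) le_kn le_i => [|k'] le_kn le_i.
      by rewrite addr0 !expr1n.
    by congr (_ ^+ _); lia.
  ring.
rewrite exchange_big /= big_ord_recr /= big1 => [|i _].
  rewrite add0r big_ord_recl big1 => [|k _]; last first.
    by rewrite /a subnn lift0 bin0n muln0 mulr0n mulr0.
  by rewrite /a subnn binn !expr0 !mulr1 addr0.
(* The coefficient of z ^+ i for i < n. *)
rewrite -mulr_sumr -[RHS](mulr0 (z ^+ i)); congr (_ * _).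
have m_gt0 : (0 < n - i)%N by rewrite subn_gt0.
have lt_pred : ((n - i).-1 < n - i)%N by rewrite prednK.
rewrite -[RHS](mulr0 ((-1) ^+ (n - i) *+ 'C(n, i))).
rewrite -[in RHS](alternating_binomial_sum 1 lt_pred).
rewrite (big_ord_widen n.+1 (fun k : nat =>
  (-1) ^+ k * (1 + k%:R) ^+ (n - i).-1 *+ 'C(n - i, k))) ?ltnS ?leq_subr //.
rewrite mulr_sumr [RHS]big_mkcond; apply: eq_bigr => k _.
rewrite ltnS; case: (leqP k (n - i)) => [le_k | gt_k]; last first.
  by rewrite (@bin_small (n - i)) ?muln0 ?mulr0n.
rewrite -signr_odd oddB // signr_addb !signr_odd.
by rewrite mulrnAl mulrnAr mulrA -mulrnA mulnC.
Qed.

(** The number of parking functions on m spaces divided by m!, that is, the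
    contribution of an interval of m occupied spaces.  The exponent m.-1 agrees
    with m - 1 even for m = 0. *)
Definition park_density (m : nat) : rat := (m.+1 ^ m.-1)%:R / m`!%:R.

Lemma park_densityE (m : nat) :
  park_density m = m.+1%:R ^ (m%:Z - 1) / m`!%:R.
Proof.
rewrite /park_density natrX; case: m => [|m]; first by rewrite expr0 exp1rz.
by have -> : m.+1%:Z - 1 = m by lia.
Qed.

(** The recursion for a single interval of x spaces: if the last car takes its
    space number c.+1, it had c.+1 possible preferences, and intervals of c and
    x - c.+1 spaces were filled before.  As (c+1) park_density c is
    (c+1)^c / c!, this is Abel's identity at z = n + 2, for x = n + 1. *)
Lemma park_density_convolution (x : nat) :
  \sum_(c < x) c.+1%:R * (park_density c * park_density (x - c.+1))
  = x%:R * park_density x.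
Proof.
case: x => [|n]; first by rewrite big_ord0 mul0r.
have fact_neq0 m : m`!%:R != 0 :> rat by rewrite pnatr_eq0 -lt0n fact_gt0.
transitivity ((n.+2%:R ^+ n : rat) / n`!%:R); last first.
  rewrite /park_density factS natrM natrX /=; field.
  by rewrite fact_neq0 nat1r pnatr_eq0.
rewrite -(abel_identity n (n.+2%:R : rat)) mulr_suml (reindex_inj rev_ord_inj) /=.
apply: eq_bigr => k _; have le_kn : (k <= n)%N by rewrite -ltnS.
rewrite /park_density !subSS subKn //.
have -> : n.+2%:R - k.+1%:R = (n - k).+1%:R :> rat.
  by rewrite -natrB ?subSS ?subSn // ltnS leqW.
rewrite -[X in _ = X / _]mulr_natr !natrX.
have -> : ('C(n, k))%:R = n`!%:R / (k`!%:R * (n - k)`!%:R) :> rat.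
  by rewrite -(bin_fact le_kn) !natrM; field; rewrite !fact_neq0.
case: (n - k)%N => [|m] /=; last rewrite exprS.
  by field; rewrite !fact_neq0.
by field; rewrite !fact_neq0.
Qed.

(** * Streets as predicates on nat *)

Fixpoint run_before (b : pred nat) (q : nat) : nat :=
  if q is p.+1 then if b p then (run_before b p).+1 else 0%N else 0%N.

Lemma eq_run_before (b b' : pred nat) q :
  (forall r, (r < q)%N -> b r = b' r) -> run_before b q = run_before b' q.
Proof.
elim: q => //= q IHq eqb; rewrite eqb // IHq // => r lt_rq.
by apply: eqb; rewrite ltnW.
Qed.

Lemma leq_run_beforeP (b : pred nat) q l :
  reflect ((l <= q)%N /\ forall r, (q - l <= r < q)%N -> b r)
          (l <= run_before b q)%N.
Proof.
elim: q l => [|q IHq] [|l] /=.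
- by apply: ReflectT; split=> // r; rewrite ltn0 andbF.
- by apply: ReflectF => -[].
- by apply: ReflectT; split=> // r; lia.
case: ifP => bq; last first.
  by apply: ReflectF => -[le_lq /(_ q)]; rewrite bq => /(_ _)/implyP; lia.
apply: (iffP (IHq l)) => -[le_lq br]; split=> // r.
  rewrite subSS ltnS => /andP[le_r]; rewrite leq_eqVlt => /predU1P[->|lt_r] //.
  by apply: br; rewrite le_r.
by move=> /andP[le_r lt_r]; apply: br; rewrite subSS le_r ltnW.
Qed.

Lemma run_before_leq (b : pred nat) q : (run_before b q <= q)%N.
Proof. by have /leq_run_beforeP[] := leqnn (run_before b q). Qed.

Lemma run_before_gap (b : pred nat) (lo hi : nat) :
  (lo <= hi)%N -> (0 < lo -> ~~ b lo.-1)%N ->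
  (forall r, (lo <= r < hi)%N -> b r) ->
  run_before b hi = (hi - lo)%N.
Proof.
move=> le_lohi free_lo full; apply/eqP; rewrite eqn_leq; apply/andP; split.
  have [_ run_full] := leq_run_beforeP _ _ _ (leqnn (run_before b hi)).
  rewrite leqNgt; apply/negP => lt_run; have le_run := run_before_leq b hi.
  have lo_gt0 : (0 < lo)%N by lia.
  by have /negP[] := free_lo lo_gt0; apply: run_full; lia.
by apply/leq_run_beforeP; split=> [|r]; [exact: leq_subr | rewrite subKn //; apply: full].
Qed.

Definition vacate (b : pred nat) (p : nat) : pred nat :=
  fun q => (q != p) && b q.

(** For x = 0, the product of [park_density] over the maximal intervals of b in
    0, ..., n-1: each interval is read off at the free space that ends it, with n
    acting as a last free space, and adjacent free spaces enclose empty
    intervals, of density 1.  A positive x stands for x further occupied spaces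
    n, ..., n+x-1; this parameter makes an induction on n possible. *)
Definition street_weight (b : pred nat) (n x : nat) : rat :=
  (\prod_(q < n | ~~ b q) park_density (run_before b q))
    * park_density (run_before b n + x).

Lemma eq_street_weight (b b' : pred nat) n x :
  (forall q, (q < n)%N -> b q = b' q) ->
  street_weight b n x = street_weight b' n x.
Proof.
move=> eqb; rewrite /street_weight (eq_run_before eqb); congr (_ * _).
apply: eq_big => q; first by rewrite eqb.
by move=> _; rewrite (@eq_run_before b b') // => r lt_rq; rewrite eqb // (ltn_trans lt_rq).
Qed.

Lemma street_weight_occupied (b : pred nat) n x :
  b n -> street_weight b n.+1 x = street_weight b n x.+1.
Proof.
by move=> bn; rewrite /street_weight big_mkcond big_ord_recr /= bn -big_mkcond
  mulr1 addSnnS.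
Qed.

Lemma street_weight_free (b : pred nat) n x :
  ~~ b n -> street_weight b n.+1 x = street_weight b n 0 * park_density x.
Proof.
by move=> /[dup] bn /negbTE bnF; rewrite /street_weight big_mkcond big_ord_recr /= bnF
  -big_mkcond addn0.
Qed.

(** Induction on n, peeling off the rightmost space of the street.  The second
    sum collects the removals among the x extra spaces.  If space n is occupied,
    it joins them and the first summand of the enlarged second sum is the removal
    of n itself; if it is free, the extra spaces form an interval by themselves
    and contribute [park_density_convolution]. *)
Lemma street_weight_removal_gen (b : pred nat) (n x : nat) :
  \sum_(p < n | b p)
     (run_before b p).+1%:R * street_weight (vacate b p) n x
  + \sum_(c < x) (run_before b n + c).+1%:R
                   * (street_weight b n c * park_density (x - c.+1))
  = (\sum_(p < n) b p + x)%:R * street_weight b n x.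
Proof.
elim: n x => [|n IHn] x.
  rewrite !big_ord0 add0r add0n /street_weight big_ord0 /= mul1r.
  rewrite -park_density_convolution; apply: eq_bigr => c _.
  by rewrite !add0n mul1r.
rewrite big_mkcond !big_ord_recr /= -big_mkcond /=.
case: ifP => bn.
- rewrite (street_weight_occupied _ bn) addn1 addSnnS -IHn -addrA.
  congr (_ + _).
    apply: eq_bigr => p _; have bpn : vacate b p n.
      by rewrite /vacate bn andbT gtn_eqF.
    by rewrite (street_weight_occupied _ bpn).
  rewrite big_ord_recl /= addn0 subn1; congr (_ + _).
    have bnn : ~~ vacate b n n by rewrite /vacate eqxx.
    rewrite (street_weight_free _ bnn) (@eq_street_weight _ b) // => q lt_q.
    by rewrite /vacate ltn_eqF.
  apply: eq_bigr => c _; rewrite (street_weight_occupied _ bn).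
  by rewrite /bump /= add1n addnS addSn subSS.
rewrite addr0 addn0 street_weight_free ?bn // mulrA -[RHS]mulrA.
have := IHn 0%N; rewrite big_ord0 addr0 addn0 => E.
rewrite natrD mulrDl [_%:R * (_ * park_density x)]mulrA -E mulr_suml; congr (_ + _).
  apply: eq_bigr => p _; have bpn : ~~ vacate b p n.
    by rewrite /vacate bn andbF.
  by rewrite (street_weight_free _ bpn) mulrA.
rewrite mulrCA -park_density_convolution mulr_sumr; apply: eq_bigr => c _.
by rewrite add0n street_weight_free ?bn //; ring.
Qed.

(** The recursion satisfied by N(S) / |S|!. *)
Lemma street_weight_removal (b : pred nat) (n : nat) :
  \sum_(p < n | b p)
     (run_before b p).+1%:R * street_weight (vacate b p) n 0
  = (\sum_(p < n) b p)%:R * street_weight b n 0.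
Proof.
by have := street_weight_removal_gen b n 0; rewrite big_ord0 addr0 addn0.
Qed.

(** * Outcomes and preferences *)

(** The set of spaces occupied by the cars below c. *)
Definition taken n (sigma : 'S_n) (c : nat) : pred nat :=
  fun q => [exists x : 'I_n, (x == q :> nat) && (sigma x < c)%N].

Lemma takenE n (sigma : 'S_n) (c : nat) (x : 'I_n) :
  taken sigma c x = (sigma x < c)%N.
Proof.
apply/existsP/idP => [[y /andP[/eqP eq_yx]]|lt_xc]; first by rewrite (ord_inj eq_yx).
by exists x; rewrite eqxx.
Qed.

(** The car in space x is maximal in a window ending at x if and only if the
    other cars of the window came earlier. *)
Lemma run_lengthE n (sigma : 'S_n) (x : 'I_n) :
  run_length x sigma = (run_before (taken sigma (sigma x)) x).+1.
Proof.
apply/eqP; rewrite eqn_leq; apply/andP; split.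
  apply/bigmax_leqP => -[[//|l] lt_ln] /= /andP[le_lx /eqP sigma_max].
  rewrite ltnS; apply/leq_run_beforeP; split=> // r /andP[le_r lt_r].
  have lt_rn : (r < n)%N by apply: ltn_trans lt_r _.
  rewrite -[r]/(nat_of_ord (Ordinal lt_rn)) takenE ltn_neqAle; apply/andP; split.
    by rewrite val_eqE (inj_eq perm_inj) -val_eqE /= ltn_eqF.
  rewrite [leqRHS]sigma_max.
  by apply: (leq_bigmax_cond (F := fun q => sigma q : nat)) => /=; lia.
have lt_run : ((run_before (taken sigma (sigma x)) x).+1 < n.+1)%N.
  by rewrite ltnS (leq_ltn_trans (run_before_leq _ _)).
apply: (leq_bigmax_cond (F := fun l : 'I_n.+1 => l : nat) (Ordinal lt_run)) => /=.
rewrite ltnS run_before_leq /= eqn_leq; apply/andP; split.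
  by apply: (leq_bigmax_cond (F := fun q => sigma q : nat)) => /=; lia.
apply/bigmax_leqP => q /andP[lt_xq]; rewrite leq_eqVlt => /predU1P[/ord_inj -> //|lt_qx].
have [_ run_taken] := leq_run_beforeP _ _ _ (leqnn (run_before (taken sigma (sigma x)) x)).
by apply: ltnW; rewrite -takenE; apply: run_taken; lia.
Qed.

Lemma targetP n (s : street n) (p x : 'I_n) :
  reflect [/\ s x = None, (p <= x)%N
            & forall q : 'I_n, (p <= q < x)%N -> s q != None]
          (target s p == Some x).
Proof.
rewrite /target; case: ifP => [/eqP sp | sp].
  apply: (iffP eqP) => [[<-] | [_ le_px full]].
    by split=> // q; case: ltngtP.
  congr Some; apply/eqP; rewrite -val_eqE eqn_leq le_px leqNgt /=.
  apply/negP => lt_px; have := full p.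
  by rewrite leqnn lt_px sp eqxx => /(_ isT).
set t := [seq q <- _ | _].
have memt q : (q \in t) = (p < q)%N && (s q == None) by rewrite mem_filter mem_enum andbT.
have sorted_t : sorted (fun a b : 'I_n => (a < b)%N) t.
  apply: sorted_filter => [a b c|]; first exact: ltn_trans.
  by rewrite -(sorted_map (f := val) (e' := ltn)) val_enum_ord iota_ltn_sorted.
apply: (iffP eqP) => [|[sx le_px full]].
  case def_t: t => [|y u] //= [def_y]; rewrite {y}def_y in def_t.
  have: x \in t by rewrite def_t mem_head.
  rewrite memt => /andP[lt_px /eqP sx]; split=> // [|q /andP[]]; first exact: ltnW.
  rewrite leq_eqVlt => /predU1P[/ord_inj <- _|lt_pq lt_qx]; first by rewrite sp.
  apply/negP => sq; have: q \in t by rewrite memt lt_pq.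
  move: sorted_t; rewrite def_t /= => /(order_path_min (fun _ _ _ => @ltn_trans _ _ _)).
  move=> /allP min_x; rewrite inE => /predU1P[eq_qx | /min_x]; last by lia.
  by rewrite eq_qx ltnn in lt_qx.
have lt_px : (p < x)%N.
  rewrite ltn_neqAle le_px andbT; apply/eqP => /ord_inj eq_px.
  by rewrite eq_px sx in sp.
have: x \in t by rewrite memt lt_px sx /=.
case def_t: t => [|y u] //; rewrite inE => /predU1P[-> //|xu].
have: y \in t by rewrite def_t mem_head.
rewrite memt => /andP[lt_py sy].
move: sorted_t; rewrite def_t /= => /(order_path_min (fun _ _ _ => @ltn_trans _ _ _)).
move=> /allP/(_ _ xu) lt_yx.
by have := full y; rewrite sy (ltnW lt_py) lt_yx => /(_ isT).
Qed.

Lemma card_interval n (m : nat) (x : 'I_n) :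
  (m <= x)%N -> #|[pred p : 'I_n | (m <= p <= x)%N]| = (x.+1 - m)%N.
Proof.
move=> le_mx; rewrite -sum1_card.
transitivity (\sum_(m <= p < x.+1) 1)%N; last by rewrite sum_nat_const_nat muln1.
rewrite (big_nat_widen _ _ n) // (big_nat_widenl _ 0) // big_mkord.
by apply: eq_bigl => p; rewrite inE ltnS andbC.
Qed.

(** The street just before the arrival of car c, if the outcome is sigma. *)
Definition snapshot n (sigma : 'S_n) (c : nat) : street n :=
  [ffun q => if (sigma q < c)%N then Some (sigma q) else None].

Lemma card_target n (sigma : 'S_n) (c : 'I_n) :
  #|[pred p | target (snapshot sigma c) p == Some ((sigma^-1)%g c)]|
  = run_length_car c sigma.
Proof.
rewrite /run_length_car run_lengthE permKV; set x := (sigma^-1)%g c.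
have le_run := run_before_leq (taken sigma c) x.
have -> : (run_before (taken sigma c) x).+1
    = (x.+1 - (x - run_before (taken sigma c) x))%N.
  by rewrite subSn ?leq_subr // subKn.
rewrite -card_interval ?leq_subr //; apply: eq_card => p; rewrite !inE.
have free q : (snapshot sigma c q != None) = taken sigma c q.
  by rewrite ffunE takenE; case: ifP.
apply/targetP/idP => [[_ le_px full]|/andP[le_p le_px]].
  rewrite le_px andbT leq_subLR addnC -leq_subLR.
  apply/leq_run_beforeP; split=> [|r]; first exact: leq_subr.
  rewrite subKn // => /andP[le_pr lt_rx].
  have lt_rn : (r < n)%N by apply: ltn_trans lt_rx _.
  rewrite -[r]/(nat_of_ord (Ordinal lt_rn)) -free; apply: full.
  by rewrite le_pr.
split=> // [|q /andP[le_pq lt_qx]]; first by rewrite ffunE permKV ltnn.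
have [_ run_taken] := leq_run_beforeP _ _ _ (leqnn (run_before (taken sigma c) x)).
by rewrite free; apply: run_taken; rewrite lt_qx (leq_trans le_p).
Qed.

Definition parked_upto n (pi : {ffun 'I_n -> 'I_n}) (c : nat) : street n :=
  foldl (park_car pi) (empty_street n) (take c (enum 'I_n)).

Lemma parked_uptoS n (pi : {ffun 'I_n -> 'I_n}) (c : 'I_n) :
  parked_upto pi c.+1 = park_car pi (parked_upto pi c) c.
Proof.
by rewrite /parked_upto (take_nth c) ?size_enum_ord // nth_ord_enum foldl_rcons.
Qed.

Lemma parked_upto_lt n (pi : {ffun 'I_n -> 'I_n}) (c : nat) (q d : 'I_n) :
  (c <= n)%N -> parked_upto pi c q = Some d -> (d < c)%N.
Proof.
elim: c => [|c IHc] lt_cn; first by rewrite /parked_upto take0 ffunE.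
rewrite (parked_uptoS pi (Ordinal lt_cn)) /park_car.
case: target => [p|]; last by move/(IHc (ltnW lt_cn)) => lt_dc; rewrite ltnW.
rewrite ffunE; case: ifP => _; first by move=> [<-].
by move/(IHc (ltnW lt_cn)) => lt_dc; rewrite ltnW.
Qed.

(** A street determines the previous one: car c is the newest car on it, and
    the space where it stands was free before. *)
Lemma snapshot_step n (pi : {ffun 'I_n -> 'I_n}) (sigma : 'S_n) (c : 'I_n) :
  parked_upto pi c.+1 = snapshot sigma c.+1 ->
  parked_upto pi c = snapshot sigma c
  /\ target (snapshot sigma c) (pi c) = Some ((sigma^-1)%g c).
Proof.
rewrite parked_uptoS /park_car; case def_p: target => [p|] eq_snap; last first.
  (* If car c left the street, it would already be there before its arrival. *)
  have: parked_upto pi c ((sigma^-1)%g c) = Some c.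
    by rewrite eq_snap ffunE permKV ltnSn.
  by move/(parked_upto_lt (ltnW (ltn_ord c))); rewrite ltnn.
have sigma_p : sigma p = c.
  have := congr1 (fun s : street n => s p) eq_snap; rewrite !ffunE eqxx.
  by case: ifP => // _ [].
have /targetP[free_p _ _] : target (parked_upto pi c) (pi c) == Some p.
  by rewrite def_p.
have eq_c : parked_upto pi c = snapshot sigma c.
  apply/ffunP => q; have := congr1 (fun s : street n => s q) eq_snap; rewrite !ffunE.
  case: eqP => [->|ne_q] eq_q; first by rewrite free_p sigma_p ltnn.
  rewrite {}eq_q ltnS leq_eqVlt; case: eqP => //= /ord_inj eq_q; case: ne_q.
  by apply: (@perm_inj _ sigma); rewrite eq_q sigma_p.
by rewrite -eq_c def_p -sigma_p permK.
Qed.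

Lemma parked_snapshotP n (pi : {ffun 'I_n -> 'I_n}) (sigma : 'S_n) :
  reflect (forall c : 'I_n, target (snapshot sigma c) (pi c) = Some ((sigma^-1)%g c))
          (parked pi == snapshot sigma n).
Proof.
have parkedE : parked pi = parked_upto pi n.
  by rewrite /parked_upto take_oversize // size_enum_ord.
apply: (iffP eqP) => [final c | targets]; last first.
  suff uptoE c : (c <= n)%N -> parked_upto pi c = snapshot sigma c.
    by rewrite parkedE uptoE.
  elim: c => [|c IHc] lt_cn.
    by apply/ffunP => q; rewrite /parked_upto take0 !ffunE.
  rewrite (parked_uptoS pi (Ordinal lt_cn)) /park_car IHc ?(ltnW lt_cn) //.
  rewrite (targets (Ordinal lt_cn)); apply/ffunP => q; rewrite !ffunE /=.
  case: eqP => [->|ne_q]; first by rewrite permKV ltnSn.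
  rewrite ltnS [in RHS]leq_eqVlt; case: eqP => //= eq_q; case: ne_q.
  by rewrite -(permK sigma q); congr (_ _); apply: ord_inj.
have snapE : forall d e, (e + d = n)%N -> parked_upto pi e = snapshot sigma e.
  elim=> [|d IHd] e; first by rewrite addn0 => ->; rewrite -parkedE.
  rewrite addnS -addSn => eq_n; have lt_en : (e < n)%N by lia.
  by have [] := snapshot_step (c := Ordinal lt_en) (IHd _ eq_n).
by have [] := snapshot_step (snapE _ _ (subnKC (ltn_ord c))).
Qed.

(** The fibre over sigma is a product of windows, one for each car: by
    [parked_snapshotP] the conditions on the preferences of different cars do not
    interact, although the cars do. *)
Lemma card_outcome n (sigma : 'S_n) :
  #|[set pi in parking_functions n | parking_outcome pi == sigma]|
  = (\prod_(c < n) run_length_car c sigma)%N.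
Proof.
pose F (c : 'I_n) := [pred p | target (snapshot sigma c) p == Some ((sigma^-1)%g c)].
transitivity #|(family F : pred {ffun 'I_n -> 'I_n})|; last first.
  rewrite card_family foldrE big_map big_enum /=.
  by apply: eq_bigr => c _; rewrite card_target.
apply: eq_card => pi; rewrite inE.
transitivity (parked pi == snapshot sigma n); last first.
  by apply/parked_snapshotP/familyP => targets c; exact/eqP/(targets c).
apply/andP/eqP => [[pf /eqP outcome] | final].
  apply/ffunP => q; rewrite ffunE ltn_ord -outcome; exact: parking_outcomeP.
have pf : pi \in parking_functions n.
  rewrite inE; apply/forallP => c; apply/existsP; exists ((sigma^-1)%g c).
  by rewrite final ffunE permKV ltn_ord.
split=> //.
apply/eqP/permP => q; apply: Some_inj.
by rewrite -parking_outcomeP // final ffunE ltn_ord.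
Qed.

(** * Summing over the positions of the early cars *)

Definition agree_from n (tau : 'S_n) (c : nat) : {set 'S_n} :=
  [set sigma : 'S_n |
    [forall d : 'I_n, (c <= d)%N ==> ((sigma^-1)%g d == (tau^-1)%g d)]].

Lemma agree_fromP n (tau sigma : 'S_n) (c : nat) :
  reflect (forall d : 'I_n, (c <= d)%N -> (sigma^-1)%g d = (tau^-1)%g d)
          (sigma \in agree_from tau c).
Proof.
rewrite inE; apply: (iffP forallP) => agree d; first by move=> /(implyP (agree d))/eqP.
by apply/implyP => /agree ->.
Qed.

Lemma eq_taken n (sigma tau : 'S_n) (c : nat) :
  (forall d : 'I_n, (c <= d)%N -> (sigma^-1)%g d = (tau^-1)%g d) ->
  taken sigma c =1 taken tau c.
Proof.
move=> agree q; apply: eq_existsb => x; congr (_ && _).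
rewrite !ltnNge; congr (~~ _); apply/idP/idP => le_c.
  suff -> : tau x = sigma x by [].
  by rewrite -[in LHS](permK sigma x) agree // permKV.
suff -> : sigma x = tau x by [].
by rewrite -[in LHS](permK tau x) -agree // permKV.
Qed.

Lemma eq_run_length_car n (sigma tau : 'S_n) (c : 'I_n) :
  (forall d : 'I_n, (c <= d)%N -> (sigma^-1)%g d = (tau^-1)%g d) ->
  run_length_car c sigma = run_length_car c tau.
Proof.
move=> agree; rewrite /run_length_car !run_lengthE !permKV agree //.
by rewrite (eq_run_before (b' := taken tau c)) // => r _; apply: eq_taken.
Qed.

Lemma sum_taken n (tau : 'S_n) (c : nat) :
  (c <= n)%N -> (\sum_(x < n) taken tau c x = c)%N.
Proof.
move=> le_cn; rewrite (reindex_inj (@perm_inj _ (tau^-1)%g)) /=.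
transitivity (\sum_(0 <= x < c) 1)%N; last by rewrite sum_nat_const_nat muln1 subn0.
rewrite (big_nat_widen _ _ n) // big_mkord [RHS]big_mkcond /=.
by apply: eq_bigr => x _; rewrite takenE permKV; case: ifP.
Qed.

(** Induction on c.  The sum is split according to the space p of car c, and
    [tau_p] is the permutation obtained from tau by moving car c to p: the
    permutations with car c in p are those that agree with [tau_p] from c on, and
    car c contributes the same run length in all of them.  What remains is
    [street_weight_removal]. *)
Lemma sum_agree_from n (tau : 'S_n) (c : nat) :
  (c <= n)%N ->
  \sum_(sigma in agree_from tau c)
     \prod_(d < n | (d < c)%N) (run_length_car d sigma)%:R
  = c`!%:R * street_weight (taken tau c) n 0.
Proof.
elim: c tau => [|c IHc] tau lt_cn.
  have -> : agree_from tau 0 = [set tau].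
    apply/setP => sigma; rewrite !inE; apply/forallP/eqP => [agree | -> d].
      by apply: invg_inj; apply/permP => d; apply/eqP/agree.
    by rewrite eqxx.
  rewrite big_set1 big_pred0 // mul1r /street_weight.
  have none q : taken tau 0 q = false.
    by apply/negbTE/existsP => -[x]; rewrite ltn0 andbF.
  have run0 q : run_before (taken tau 0) q = 0%N by case: q => //= q; rewrite none.
  by rewrite run0 big1 ?mul1r ?divr1 // => q _; rewrite run0 /park_density.
pose car := Ordinal lt_cn.
rewrite (partition_big (fun sigma : 'S_n => (sigma^-1)%g car)
          (fun p => taken tau c.+1 p)) => [|sigma /agree_fromP agree] /=; last first.
  by rewrite -(eq_taken agree) takenE permKV /=.
have := street_weight_removal (taken tau c.+1) n; rewrite sum_taken // => removal.
rewrite factS natrM mulrAC -removal mulr_suml.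
apply: eq_bigr => p taken_p.
have le_pc : (tau p <= c)%N by rewrite -ltnS -takenE.
pose tau_p : 'S_n := (tau * tperm (tau p) car)%g.
have tau_pV d : (tau_p^-1)%g d = (tau^-1)%g (tperm (tau p) car d).
  by rewrite /tau_p invMg tpermV permM.
have tau_p_car : (tau_p^-1)%g car = p by rewrite tau_pV tpermR permK.
have tau_p_agree (d : 'I_n) : (c < d)%N -> (tau_p^-1)%g d = (tau^-1)%g d.
  move=> lt_cd; rewrite tau_pV tpermD // -val_eqE /= ltn_eqF //.
  exact: leq_ltn_trans lt_cd.
have taken_vacate q : (q < n)%N -> taken tau_p c q = vacate (taken tau c.+1) p q.
  move=> lt_qn; rewrite -[q]/(nat_of_ord (Ordinal lt_qn)); set x := Ordinal lt_qn.
  rewrite /vacate !takenE permM ltnS; case: eqVneq => [/ord_inj -> | ne_xp] /=.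
    by rewrite tpermL ltnn.
  have ne_tau : tau x != tau p by rewrite (inj_eq perm_inj).
  case: tpermP ne_tau => [-> | eq_x | _ ne_car _]; first by rewrite eqxx.
    rewrite eq_x leqnn => ne_car; rewrite ltn_neqAle le_pc andbT.
    by apply: contraNneq ne_car => eq_c; apply/eqP/ord_inj.
  by rewrite [RHS]leq_eqVlt; case: eqP => // eq_c; case: ne_car; apply: ord_inj.
transitivity (\sum_(sigma in agree_from tau_p c)
    (run_before (taken tau c.+1) p).+1%:R
      * \prod_(d < n | (d < c)%N) (run_length_car d sigma)%:R : rat); last first.
  rewrite -mulr_sumr IHc ?(ltnW lt_cn) // mulrCA.
  by rewrite (eq_street_weight 0 taken_vacate) mulrC mulrAC.
apply: eq_big => [sigma | sigma].
  apply/andP/agree_fromP => [[/agree_fromP agree /eqP sigma_car] d | agree].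
    rewrite leq_eqVlt => /predU1P[eq_d | lt_cd]; last by rewrite agree // tau_p_agree.
    by rewrite (_ : d = car) ?sigma_car ?tau_p_car //; apply: ord_inj.
  split; last by rewrite agree // tau_p_car.
  by apply/agree_fromP => d lt_cd; rewrite agree ?tau_p_agree // ltnW.
move=> /andP[/agree_fromP agree /eqP sigma_car].
rewrite (bigD1 car) //=; congr (_ * _).
  rewrite /run_length_car run_lengthE permKV sigma_car; congr (_.+1%:R).
  apply: eq_run_before => r lt_rp; have lt_rn : (r < n)%N by apply: ltn_trans lt_rp _.
  rewrite (eq_taken (tau := tau_p)) => [|d]; last first.
    rewrite leq_eqVlt => /predU1P[eq_d | lt_cd]; last by rewrite agree // tau_p_agree.
    by rewrite (_ : d = car) ?sigma_car ?tau_p_car //; apply: ord_inj.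
  by rewrite taken_vacate // /vacate ltn_eqF.
by apply: eq_bigl => d; rewrite -val_eqE /= ltnS ltn_neqAle andbC.
Qed.

(** * The probability of the event *)

(** All permutations agree from n on, so the sum over outcomes is given by
    [sum_agree_from] for the full street. *)
Lemma card_parking_functions n : #|parking_functions n| = (n.+1 ^ n.-1)%N.
Proof.
have -> : #|parking_functions n|
    = (\sum_(sigma : 'S_n) \prod_(c < n) run_length_car c sigma)%N.
  rewrite -sum1_card (partition_big (@parking_outcome n) xpredT) //=.
  by apply: eq_bigr => sigma _; rewrite -card_outcome -sum1_card; apply: eq_bigl => pi;
    rewrite inE.
apply/eqP; rewrite -(eqr_nat rat) natr_sum.
have full q : (q < n)%N -> taken (1%g : 'S_n) n q.
  by move=> lt_qn; rewrite -[q]/(nat_of_ord (Ordinal lt_qn)) takenE.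
have weight_full : street_weight (taken (1%g : 'S_n) n) n 0 = park_density n.
  rewrite /street_weight big1 ?mul1r => [|q]; last by rewrite full.
  by rewrite addn0 (@run_before_gap _ 0) // subn0.
have := sum_agree_from (1%g : 'S_n) (leqnn n).
rewrite weight_full /park_density mulrCA divff; last first.
  by rewrite pnatr_eq0 -lt0n fact_gt0.
rewrite mulr1 => <-; apply/eqP; apply: eq_big => [sigma|sigma _].
  by apply/esym/agree_fromP => d; rewrite leqNgt ltn_ord.
by rewrite natr_prod; apply: eq_bigl => d; rewrite ltn_ord.
Qed.

Lemma Ppark_eventE n (A : {set 'S_n}) :
  Ppark_event A = (\sum_(sigma in A) \prod_(c < n) (run_length_car c sigma)%:R)
                    / (n.+1 ^ n.-1)%:R.
Proof.
rewrite /Ppark_event mulr_suml; apply: eq_bigr => sigma _.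
by rewrite /Ppark card_outcome card_parking_functions natr_prod.
Qed.

Lemma prod_last_cars n j (hjn : (j <= n)%N) (F : 'I_n -> rat) :
  \prod_(c < n | (n - j <= c)%N) F c = \prod_(m < j) F (last_car hjn m).
Proof.
rewrite big_mkcond (reindex (cast_ord (subnK hjn))) /=; last first.
  exact: onW_bij (Bijective (cast_ordK _) (cast_ordKV _)).
rewrite big_split_ord /=.
rewrite big1 ?mul1r => [|l _]; last by rewrite leqNgt ltn_ord.
by apply: eq_bigr => m _; rewrite leq_addr.
Qed.

Lemma last_carP n j (hjn : (j <= n)%N) (c : 'I_n) :
  (n - j <= c)%N -> exists m, c = last_car hjn m.
Proof.
move=> le_c; have lt_m : (c - (n - j) < j)%N by have := ltn_ord c; lia.
by exists (Ordinal lt_m); apply: ord_inj; rewrite /= subnKC.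
Qed.

Lemma last_cars_at_agree n j (hjn : (j <= n)%N) (i : 'I_j -> 'I_n) (sigma : 'S_n) :
  sigma \in last_cars_at hjn i -> last_cars_at hjn i = agree_from sigma (n - j).
Proof.
rewrite inE => /forallP at_i; apply/setP => tau; rewrite inE.
apply/forallP/agree_fromP => [tau_at d le_d | agree m].
  have [m ->] := last_carP hjn le_d.
  by rewrite (eqP (at_i m)) (eqP (tau_at m)).
by rewrite agree ?at_i //= leq_addr.
Qed.

Lemma sum_last_cars_at n j (hjn : (j <= n)%N) (i : 'I_j -> 'I_n) (sigma : 'S_n) :
  sigma \in last_cars_at hjn i ->
  \sum_(tau in last_cars_at hjn i) \prod_(c < n) (run_length_car c tau)%:R
  = \prod_(m < j) (run_length_car (last_car hjn m) sigma)%:R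
      * ((n - j)`!%:R * street_weight (taken sigma (n - j)) n 0).
Proof.
move=> at_i; rewrite (last_cars_at_agree at_i) -sum_agree_from ?leq_subr // mulr_sumr.
apply: eq_bigr => tau /agree_fromP agree.
rewrite (bigID (fun c : 'I_n => (n - j <= c)%N)) /= prod_last_cars.
congr (_ * _); last by apply: eq_bigl => c; rewrite ltnNge.
apply: eq_bigr => m _; congr (_%:R); apply: eq_run_length_car => d le_d.
by apply: agree; apply: leq_trans le_d; rewrite leq_addr.
Qed.

Lemma gap_ends n j (i : 'I_j -> 'I_n) (k : nat -> nat) (l : nat) :
  k 0%N = 0%N -> (forall l : nat, (1 <= l < j)%N -> (k l < k l.+1)%N) ->
  perm_eq [seq k l | l <- iota 1 j] [seq (i m).+1 | m <- enum 'I_j] ->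
  (1 <= l <= j)%N -> (k l.-1 < k l <= n)%N.
Proof.
move=> k0 kS perm_k l_in.
have: k l \in [seq k l | l <- iota 1 j] by apply: map_f; rewrite mem_iota add1n ltnS.
rewrite (perm_mem perm_k) => /mapP[m _ kl]; have le_kl : (k l <= n)%N by rewrite kl.
rewrite le_kl andbT; case: l => [|[|l]] // in l_in kl {le_kl} *; first by rewrite k0 kl.
exact: kS.
Qed.

(** The free spaces are the (k l).-1 in 0-based numbering, and the run before
    the l-th of them starts at space k l.-1, just after the previous free space;
    k 0 = 0 makes this also true of the first run. *)
Lemma street_weight_gaps n j (hjn : (j <= n)%N) (i : 'I_j -> 'I_n)
    (k : nat -> nat) (sigma : 'S_n) :
  k 0%N = 0%N -> (forall l : nat, (1 <= l < j)%N -> (k l < k l.+1)%N) ->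
  perm_eq [seq k l | l <- iota 1 j] [seq (i m).+1 | m <- enum 'I_j] ->
  sigma \in last_cars_at hjn i ->
  street_weight (taken sigma (n - j)) n 0
  = (\prod_(1 <= l < j.+1) park_density (k l - k l.-1 - 1)) * park_density (n - k j).
Proof.
move=> k0 kS perm_k; rewrite inE => /forallP at_i.
have k_pred l : (1 <= l <= j)%N -> (k l.-1 < k l)%N.
  by move=> /(gap_ends k0 kS perm_k)/andP[].
have k_mono l l' : (l <= l' <= j)%N -> (k l <= k l')%N.
  elim: l' => [|l' IHl']; first by rewrite leqn0 => /andP[/eqP ->].
  rewrite leq_eqVlt => /andP[/predU1P[-> //|lt_l] le_l'].
  apply: leq_trans (IHl' _) _; first by rewrite -ltnS lt_l ltnW.
  exact/ltnW/(k_pred l'.+1).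
have le_kn l : (l <= j)%N -> (k l <= n)%N.
  by case: l => [|l] le_lj; [rewrite k0 | have /andP[] := gap_ends (l := l.+1) k0 kS perm_k le_lj].
set b := taken sigma (n - j).
have freeP q : (q < n)%N -> reflect (exists2 l, (1 <= l <= j)%N & k l = q.+1) (~~ b q).
  move=> lt_qn; have -> : ~~ b q = (q.+1 \in [seq k l | l <- iota 1 j]).
    rewrite (perm_mem perm_k) -[q]/(nat_of_ord (Ordinal lt_qn)) /b takenE -leqNgt.
    apply/idP/mapP => [/(last_carP hjn)[m def_m] | [m _ /= [eq_q]]].
      exists m; first by rewrite mem_enum.
      by rewrite -(eqP (at_i m)) -def_m permK.
    have -> : Ordinal lt_qn = i m by apply: ord_inj.
    by rewrite -(eqP (at_i m)) permKV leq_addr.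
  apply: (iffP mapP) => -[l l_in eq_l]; exists l => //.
    by rewrite mem_iota add1n ltnS in l_in.
  by rewrite mem_iota add1n ltnS.
have run_gap l q : (l <= j)%N -> (k l <= q <= n)%N ->
    (l < j -> q < k l.+1)%N -> run_before b q = (q - k l)%N.
  move=> le_lj /andP[le_klq le_qn] next; apply: run_before_gap => // [kl_gt0 | r].
    apply/freeP; first by have := le_kn l le_lj; lia.
    exists l; last by rewrite prednK.
    by rewrite le_lj andbT lt0n; apply: contraTneq kl_gt0 => ->; rewrite k0.
  move=> /andP[le_r lt_rq]; apply: contraT => /freeP[|l' l'_in kl'].
    exact: leq_trans le_qn.
  have [le_l'l | lt_ll'] := leqP l' l.
    have le_k : (k l' <= k l)%N by apply: k_mono; lia.
    by lia.
  have /next lt_q : (l < j)%N by lia.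
  have le_k : (k l.+1 <= k l')%N by apply: k_mono; lia.
  by lia.
rewrite /street_weight addn0 (run_gap j) ?le_kn ?leqnn ?ltnn //.
congr (_ * _).
rewrite (reindex_inj (@perm_inj _ (sigma^-1)%g)) /=.
transitivity (\prod_(c < n | (n - j <= c)%N) park_density (run_before b ((sigma^-1)%g c))).
  by apply: eq_bigl => c; rewrite /b takenE permKV -leqNgt.
(* The product now runs over the free spaces in order of their cars; the
   hypothesis on k rearranges them in increasing order. *)
rewrite prod_last_cars.
transitivity (\prod_(x <- [seq (i m).+1 | m <- enum 'I_j]) park_density (run_before b x.-1)).
  by rewrite big_map big_enum /=; apply: eq_bigr => m _; rewrite (eqP (at_i m)).
rewrite -(perm_big _ perm_k) big_map /index_iota subSS subn0.
rewrite big_seq [RHS]big_seq; apply: eq_bigr => l.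
rewrite mem_iota add1n ltnS => l_in; congr (park_density _).
have lt_k := k_pred l l_in; have /andP[l_gt0 le_lj] := l_in.
have le_k := le_kn l le_lj.
rewrite (run_gap l.-1) ?prednK //; by lia.
Qed.

Theorem theorem3 (n j : nat) (hj : (1 <= j)%N) (hjn : (j <= n)%N)
    (i : 'I_j -> 'I_n) (hi : injective i)
    (k : nat -> nat) (hk0 : k 0%N = 0%N)
    (hkmono : forall l : nat, (1 <= l < j)%N -> (k l < k l.+1)%N)
    (hkperm : perm_eq [seq k l | l <- iota 1 j] [seq (i m).+1 | m <- enum 'I_j]) :
  (forall sigma tau : 'S_n,
     sigma \in last_cars_at hjn i -> tau \in last_cars_at hjn i ->
     forall m : 'I_j,
       run_length_car (last_car hjn m) sigma = run_length_car (last_car hjn m) tau)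
  /\
  (forall sigma : 'S_n, sigma \in last_cars_at hjn i ->
     Ppark_event (last_cars_at hjn i) =
       (((n - j)`!)%:R
         * (\prod_(1 <= l < j.+1)
              ((k l)%:R - (k l.-1)%:R) ^ ((k l)%:Z - (k l.-1)%:Z - 2))
         * (n%:R - (k j)%:R + 1) ^ (n%:Z - (k j)%:Z - 1)
         * \prod_(m < j) (run_length_car (last_car hjn m) sigma)%:R)
       / ((n%:R + 1) ^ (n%:Z - 1)
         * (\prod_(1 <= l < j.+1) ((k l - k l.-1 - 1)`!)%:R)
         * ((n - k j)`!)%:R)).
Proof.
split=> [sigma tau at_sigma at_tau m | sigma at_sigma].
  apply: eq_run_length_car => d le_d.
  move: at_sigma; rewrite (last_cars_at_agree at_tau) => /agree_fromP; apply.
  by apply: leq_trans le_d; rewrite leq_addr.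
have k_gap := gap_ends hk0 hkmono hkperm.
rewrite Ppark_eventE (sum_last_cars_at at_sigma).
rewrite (street_weight_gaps hk0 hkmono hkperm at_sigma).
have /andP[_ le_kjn] : (k j.-1 < k j <= n)%N by apply: (k_gap j); rewrite hj leqnn.
have densE l : (1 <= l < j.+1)%N -> park_density (k l - k l.-1 - 1)
    = ((k l)%:R - (k l.-1)%:R) ^ ((k l)%:Z - (k l.-1)%:Z - 2)
      / (k l - k l.-1 - 1)`!%:R.
  rewrite ltnS => /k_gap/andP[lt_k _]; rewrite park_densityE subn1 prednK ?subn_gt0 //.
  by rewrite natrB ?(ltnW lt_k) //; congr (_ ^ _ / _); lia.
rewrite (eq_big_nat _ _ densE) big_split /= prodfV.
rewrite park_densityE -[(n - k j).+1%:R]natr1 natrB // -subzn //.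
have -> : (n.+1 ^ n.-1)%:R = (n%:R + 1) ^ (n%:Z - 1) :> rat.
  by rewrite natrX natr1 (_ : n%:Z - 1 = n.-1) //; lia.
rewrite !invfM; ring.
Qed.
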